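(* Let $m\ge 2$, $n=(3^m-1)/2$, $n'=(3^{m-1}-1)/2=(n-1)/3$. Let $C\subset\mathbb{F}_3^n$ be a $3$-ary $1$-perfect code of length $n$ of rank at most $+1$ (that is, of rank at most $n-m+1$), and let $C^\star\subset\mathbb{F}_3^{n'}$ be the $3$-ary Hamming code of length $n'$. Then for some automorphism $\psi$ of the Hamming graph $H(n,3)$ it holds $$\psi(C)=\bigcup_{\bar\mu\in C^\star}K_{\bar\mu},$$ where, for $\bar\mu=(\mu_0,\ldots,\mu_{n'-1})$, $$K_{\bar\mu}=\big\{(x_0,\ldots,x_{n-1})\in\mathbb{F}_3^n:\ x_2=\mu_0-x_0-x_1,\ x_5=\mu_1-x_3-x_4,\ \ldots,\ x_{n-2}=\mu_{(n-4)/3}-x_{n-4}-x_{n-3},\ x_{n-1}=\lambda_{\bar\mu}(x_1-x_0,\,x_4-x_3,\,\ldots,\,x_{n-3}-x_{n-4})\big\}$$ for some $(n-1)/3$-ary quasigroups $\lambda_{\bar\mu}$ of order $3$, $\bar\mu\in C^\star$.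
   Context: The Hamming graph $H(n,3)$ has vertex set $\{0,1,2\}^n=\mathbb{F}_3^n$, two words being adjacent iff they differ in exactly one position. An automorphism of $H(n,3)$ is a composition of a coordinate permutation and an isotopy (independent permutations of the alphabet in each coordinate). A $1$-perfect code is a set of pairwise non-adjacent vertices such that every vertex not in the set is adjacent to exactly one element of the set. The rank of a code is the dimension of its affine span over $\mathbb{F}_3$; a $1$-perfect code of length $n=(3^m-1)/2$ has rank $+r$ if its rank is $(n-m)+r$. The Hamming code of length $(3^k-1)/2$ is the linear $1$-perfect code of that length (unique up to equivalence), i.e. the kernel of a check matrix whose columns form a maximal collection of pairwise non-collinear nonzero columns of height $k$; for $k=1$ it is $\{0\}\subset\mathbb{F}_3$. A $t$-ary quasigroup of order $3$ is a function $f:\{0,1,2\}^t\to\{0,1,2\}$ whose graph $\{(\bar x,f(\bar x))\}$ has minimum Hamming distance at least $2$, i.e. changing exactly one argument always changes the value. *)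

(* Defs.v *)
From HB Require Import structures.
From mathcomp Require Import all_boot all_order all_fingroup all_algebra.
From mathcomp Require Import zify.

Set Implicit Arguments.
Unset Strict Implicit.
Unset Printing Implicit Defensive.

Import GRing.Theory.
Local Open Scope ring_scope.

Definition hdist (n : nat) (x y : 'rV['F_3]_n) : nat :=
  #|[set i : 'I_n | x 0 i != y 0 i]|.

Definition hadj (n : nat) (x y : 'rV['F_3]_n) : bool := hdist x y == 1%N.

Definition isotopy (n : nat) (s : 'I_n -> {perm 'F_3}) (x : 'rV['F_3]_n) :
  'rV['F_3]_n := \row_(i < n) s i (x 0 i).

Definition hamming_automorphism (n : nat)
    (psi : 'rV['F_3]_n -> 'rV['F_3]_n) : Prop :=
  exists (p : 'S_n) (s : 'I_n -> {perm 'F_3}),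
    psi =1 isotopy s \o col_perm p.

Definition perfect_code (n : nat) (C : {set 'rV['F_3]_n}) : Prop :=
  (forall x y, x \in C -> y \in C -> ~~ hadj x y) /\
  (forall v, v \notin C -> #|[set c in C | hadj v c]| = 1%N).

Definition affine_span (n : nat) (C : {set 'rV['F_3]_n}) :
    {set 'rV['F_3]_n} :=
  [set v | [exists a : {ffun 'rV['F_3]_n -> 'F_3},
     (\sum_(c in C) a c == 1) && (v == \sum_(c in C) a c *: c)]].

(* The dimension of a nonempty affine subspace is that of its direction, the
   linear subspace spanned by the differences of its points. *)
Definition affine_dim (n : nat) (A : {set 'rV['F_3]_n}) : nat :=
  \dim <<[seq x - y | x <- enum A, y <- enum A]>>%VS.

Definition code_rank (n : nat) (C : {set 'rV['F_3]_n}) : nat :=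
  affine_dim (affine_span C).

Definition hlen (m : nat) : nat := ((3 ^ m - 1) %/ 2)%N.

Definition collinear (k : nat) (u v : 'cV['F_3]_k) : Prop :=
  (exists a, u = a *: v) \/ (exists a, v = a *: u).

Definition hamming_check_matrix (k n : nat) (H : 'M['F_3]_(k, n)) : Prop :=
  [/\ forall i, col i H != 0,
      forall i j, i != j -> ~ collinear (col i H) (col j H)
    & forall v : 'cV['F_3]_k, v != 0 -> exists i, collinear v (col i H)].

Definition hamming_code (k : nat) (D : {set 'rV['F_3]_(hlen k)}) : Prop :=
  exists H : 'M['F_3]_(k, hlen k),
    hamming_check_matrix H /\ D = [set x | H *m x^T == 0].

Definition graph (t : nat) (f : 'rV['F_3]_t -> 'F_3) :
    {set 'rV['F_3]_(t + 1)} :=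
  [set row_mx x (const_mx (f x)) | x : 'rV['F_3]_t].

Definition quasigroup (t : nat) (f : 'rV['F_3]_t -> 'F_3) : Prop :=
  forall u v, u \in graph f -> v \in graph f -> u != v -> (2 <= hdist u v)%N.

(* The coordinate of x at position j counted from 0, with the junk value 0
   when j >= n; every position occurring in [Kset] is in range by [hlenE]. *)
Definition entry (n : nat) (x : 'rV['F_3]_n) (j : nat) : 'F_3 :=
  if insub j is Some i then x 0 i else 0.

Lemma entryE (n : nat) (x : 'rV['F_3]_n) (i : 'I_n) : entry x i = x 0 i.
Proof. by rewrite /entry valK. Qed.

Lemma hlenE (m : nat) : (0 < m)%N -> hlen m = (3 * hlen m.-1 + 1)%N.
Proof.
case: m => // m _; rewrite /hlen /= expnS.
have : odd (3 ^ m) by rewrite oddX orbT.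
by move: (3 ^ m)%N => k; lia.
Qed.

Definition Kset (m : nat) (mu : 'rV['F_3]_(hlen m.-1))
    (lambda : 'rV['F_3]_(hlen m.-1) -> 'F_3) : {set 'rV['F_3]_(hlen m)} :=
  [set x : 'rV['F_3]_(hlen m) |
     [forall i : 'I_(hlen m.-1),
        entry x (3 * i + 2)%N == mu 0 i - entry x (3 * i)%N - entry x (3 * i + 1)%N]
     && (entry x (hlen m).-1 ==
         lambda (\row_(i < hlen m.-1)
                   (entry x (3 * i + 1)%N - entry x (3 * i)%N)))].

(* Main.v *)
Require Import Defs.
From HB Require Import structures.
From mathcomp Require Import all_boot all_order all_fingroup all_algebra.
From mathcomp Require Import zify ring.

Set Implicit Arguments.
Unset Strict Implicit.
Unset Printing Implicit Defensive.

Import GRing.Theory.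
Local Open Scope ring_scope.

(* A rank bound of n - m + 1 yields m - 1 independent linear forms, collected in
   a matrix G, that are constant on C. As the unit balls around codewords tile
   the space and a linear map has equal fibres, the ball around 0 meets each
   fibre of x |-> xG in exactly three words: G has one zero row and, for each
   t <> 0, three rows in {t, -t}. A translation, a coordinate permutation and
   sign changes thus move C so that the vector of sums over triples of
   coordinates of each codeword lies in the Hamming code C*.

   In the transformed code, a word x whose vector of triple sums is in C* becomes
   a codeword for exactly one choice of its last coordinate. This choice colours
   such words with three colours, and words at distance 2 outside the last
   coordinate get different colours because the minimum distance is 3. Hence
   within one triple the colour depends only on the difference x_1 - x_0, and
   injectively so. *)

Lemma F3_cases (a : 'F_3) : [\/ a = 0, a = 1 | a = -1].
Proof.
case: a => [[|[|[|k]]] Hk] //; [apply: Or31|apply: Or32|apply: Or33];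
  exact/val_inj.
Qed.

Lemma oppr_eq_F3 (k : nat) (t : 'rV['F_3]_k) : (- t == t) = (t == 0).
Proof.
apply/eqP/eqP => [/rowP E|->]; last by rewrite oppr0.
apply/rowP => i; move: (E i); rewrite !mxE.
by case: (F3_cases (t 0 i)) => -> // /eqP.
Qed.

(** * Distances and neighbours in the Hamming graph *)

Section Distance.
Variable n : nat.
Implicit Types (x y v c : 'rV['F_3]_n).

Lemma hdistC x y : hdist x y = hdist y x.
Proof. by apply: eq_card => i; rewrite !inE eq_sym. Qed.

Lemma hdist_eq0 x y : (hdist x y == 0%N) = (x == y).
Proof.
rewrite cards_eq0; apply/eqP/eqP => [E|->].
  apply/rowP => i; apply/eqP; apply: contraFT (in_set0 i) => xy.
  by rewrite -E inE.
by apply/setP => i; rewrite !inE eqxx.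
Qed.

Lemma hdist_shift x y (i : 'I_n) (a : 'F_3) :
  y = x + a *: delta_mx 0 i -> hdist x y = (a != 0).
Proof.
move=> ->; rewrite /hdist; have [->|a0] /= := eqVneq a 0.
  by rewrite scale0r addr0; apply/eqP; rewrite hdist_eq0.
apply: etrans (cards1 i); apply: eq_card => j; rewrite !inE !mxE eqxx /=.
rewrite -{1}[x 0 j]addr0 (inj_eq (addrI _)) eq_sym.
by have [_|_] := eqVneq j i; rewrite ?mulr1 // mulr0 eqxx.
Qed.

Lemma hadjP x y :
  reflect (exists i, exists2 a, a != 0 & y = x + a *: delta_mx 0 i) (hadj x y).
Proof.
apply: (iffP idP) => [/cards1P [i /setP E]|[i [a a0 /hdist_shift]]]; last first.
  by rewrite /hadj a0 => ->.
exists i; exists (y 0 i - x 0 i).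
  by have := E i; rewrite !inE eqxx subr_eq0 eq_sym.
apply/rowP => j; rewrite !mxE eqxx /=; have := E j; rewrite !inE.
have [->|_ /negbFE/eqP ->] := eqVneq j i; first by rewrite mulr1 addrC subrK.
by rewrite mulr0 addr0.
Qed.

(** Since [1] and [-1] are the nonzero scalars, each neighbour of [c] is reached by exactly one
    index and one sign. Writing adjacency as a sum lets unit balls be counted by exchanging sums. *)
Lemma hadj_sum c v :
  (\sum_(i < n) ((c + delta_mx 0 i == v)%R + (c - delta_mx 0 i == v)%R) =
   hadj c v :> nat)%N.
Proof.
have eE i j : (delta_mx 0 i : 'rV['F_3]_n) 0 j = (j == i)%:R by rewrite mxE.
have hadjE i a : a != 0 -> (c + a *: delta_mx 0 i == v) -> hadj c v.
  by move=> a0 /eqP <-; apply/hadjP; exists i, a.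
have [/hadjP [k [a a0 ->]]|/negP nadj] := boolP (hadj c v); last first.
  rewrite big1 // => i _.
  have /negPf -> : c + delta_mx 0 i != v.
    by apply/negP => E; apply: nadj; apply: (hadjE i 1); rewrite ?scale1r.
  have /negPf -> // : c - delta_mx 0 i != v.
  by apply/negP => E; apply: nadj; apply: (hadjE i (-1)); rewrite ?scaleN1r.
have e0 i : (delta_mx 0 i : 'rV['F_3]_n) != 0.
  by apply/eqP => /rowP/(_ i)/eqP; rewrite eE mxE eqxx.
rewrite (bigD1 k) //= big1 => [|i ik]; last first.
  rewrite !(inj_eq (addrI _)) eqr_oppLR.
  case: eqP => [/rowP/(_ i)/eqP|_].
    by rewrite !mxE !eqxx (negPf ik) mulr0 oner_eq0.
  case: eqP => [/rowP/(_ i)/eqP|//].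
  by rewrite !mxE !eqxx (negPf ik) mulr0 oppr0 oner_eq0.
rewrite !(inj_eq (addrI _)).
case: (F3_cases a) a0 => -> // _.
  by rewrite scale1r eqxx oppr_eq_F3 (negPf (e0 k)).
by rewrite scaleN1r eqxx eq_sym oppr_eq_F3 (negPf (e0 k)).
Qed.

Lemma hdist_le1 x y : (hdist x y <= 1)%N = (x == y) || hadj x y.
Proof. by rewrite leq_eqVlt ltnS leqn0 hdist_eq0 orbC. Qed.

Lemma hadj_sym x y : hadj x y = hadj y x.
Proof. by rewrite /hadj hdistC. Qed.

End Distance.

(** * Perfect codes as tilings by unit balls *)

Section Perfect.
Variables (n : nat) (C : {set 'rV['F_3]_n}).
Hypothesis perfC : perfect_code C.

Lemma perfect_code_cover (v : 'rV['F_3]_n) :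
  exists2 c, c \in C & (hdist v c <= 1)%N.
Proof.
have [vC|/(proj2 perfC)/eqP/cards1P [c /setP/(_ c)]] := boolP (v \in C).
  by exists v; rewrite // hdist_le1 eqxx.
by rewrite !inE eqxx => /andP [cC vc]; exists c; rewrite // hdist_le1 vc orbT.
Qed.

(** At distance 2, replacing one of the two differing entries of [c] by that of [d] gives a word
    adjacent to both, against the uniqueness of the neighbouring codeword. *)
Lemma perfect_code_dist (c d : 'rV['F_3]_n) :
  c \in C -> d \in C -> (hdist c d <= 2)%N -> c = d.
Proof.
move=> cC dC; rewrite leq_eqVlt ltnS hdist_le1 (negPf (proj1 perfC _ _ cC dC)).
rewrite orbF => /orP [/cards2P [i [j [ij cd]]]|/eqP //].
have /setP cdE := cd.
pose v := c + (d 0 i - c 0 i) *: delta_mx 0 i.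
have vE k : v 0 k = if k == i then d 0 k else c 0 k.
  rewrite !mxE eqxx /=; case: eqP => [->|_]; first by rewrite mulr1 addrC subrK.
  by rewrite mulr0 addr0.
have cv : hadj v c.
  rewrite hadj_sym; apply/hadjP; exists i, (d 0 i - c 0 i) => //.
  by have := cdE i; rewrite !inE eqxx subr_eq0 eq_sym.
have dv : hadj v d.
  apply/cards1P; exists j; apply/setP => k; have := cdE k.
  rewrite !inE vE; have [->|//] := eqVneq k i.
  by rewrite eqxx (negPf ij).
have vC : v \notin C by apply: contraL cv => /(proj1 perfC) ->.
have /eqP/cards1P [b /setP E] := proj2 perfC v vC.
have := E c; have := E d; rewrite !inE cC dC cv dv.
by move=> /esym/eqP -> /esym/eqP ->.
Qed.

Lemma perfect_code_sum (v : 'rV['F_3]_n) :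
  (\sum_(c in C) ((c == v) + \sum_(i < n) ((c + delta_mx 0 i == v)%R +
     (c - delta_mx 0 i == v)%R)) = 1)%N.
Proof.
under eq_bigr => c _ do rewrite hadj_sum hadj_sym.
have [vC|vC] := boolP (v \in C).
  rewrite (bigD1 v) //= eqxx big1 => [|c /andP [cC /negPf ->]]; last first.
    by rewrite (negPf (proj1 perfC _ _ vC cC)).
  by rewrite (negPf (proj1 perfC _ _ vC vC)).
rewrite -[RHS](proj2 perfC v vC) -sum1dep_card [RHS]big_mkcondr /=.
by apply: eq_bigr => c cC; case: eqP cC => [->|_ _]; rewrite ?(negPf vC) //;
  case: hadj.
Qed.

End Perfect.

(** * Parity checks from the rank bound *)

(** The columns of [G] are linear forms vanishing on the direction [W] of the affine span. Such
    forms make up a space of dimension at least [k], because [\dim W] is at most [n - k]. *)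
Lemma code_rank_check (n k : nat) (C : {set 'rV['F_3]_n}) :
  (k <= n)%N -> (code_rank C <= n - k)%N ->
  exists2 G : 'M['F_3]_(n, k), \rank G = k &
    forall c d, c \in C -> d \in C -> c *m G = d *m G.
Proof.
move=> kn; rewrite /code_rank /affine_dim.
set W := span _ => dimW.
pose A := \matrix_(i < \dim W) (vbasis W)`_i.
have WA (w : 'rV_n) : w \in W -> (w <= A)%MS.
  move=> /coord_vbasis ->; apply: summx_sub => i _; apply: scalemx_sub.
  by rewrite -(rowK (fun i => (vbasis W)`_i)) row_sub.
have spanC c : c \in C -> c \in affine_span C.
  move=> cC; rewrite inE; apply/existsP; exists [ffun d => (d == c)%:R].
  have c0 d : d != c -> [ffun d => (d == c)%:R : 'F_3] d = 0.
    by rewrite ffunE => /negPf ->.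
  apply/andP; split; apply/eqP; rewrite (bigD1 c) //= ffunE eqxx ?scale1r;
    rewrite big1 ?addr0 // => d /andP [_ /c0 ->] //; exact: scale0r.
have rkK : (k <= \rank (kermx A^T))%N.
  rewrite mxrank_ker mxrank_tr; have := rank_leq_row A; lia.
(* [pid_mx k] selects the first [k] vectors of a basis of the annihilator of [W]. *)
pose B : 'M['F_3]_(k, n) := pid_mx k *m row_base (kermx A^T).
exists B^T => [|c d cC dC].
  by rewrite mxrank_tr mxrankMfree ?row_base_free // rank_pid_mx.
apply/eqP; rewrite -subr_eq0 -mulmxBl; apply/eqP.
have /WA/submxP [u ->] : c - d \in W.
  apply: memv_span; apply/allpairsP; exists (c, d).
  by rewrite !mem_enum !spanC.
rewrite -mulmxA -[A]trmxK -trmx_mul (_ : B *m _ = 0) ?trmx0 ?mulmx0 //.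
apply/sub_kermxP; apply: submx_trans (submxMl _ _) _.
by rewrite eq_row_base.
Qed.

(** With [w] a left inverse of [G], translation by [(t - u) *m w] carries the fibre over [u] onto
    the fibre over [t], so all fibres have the same size. *)
Lemma card_mulmx_fiber (F : finFieldType) (n k : nat) (G : 'M[F]_(n, k))
    (t : 'rV[F]_k) : \rank G = k ->
  (#|[set v : 'rV[F]_n | v *m G == t]| * #|F| ^ k = #|F| ^ n)%N.
Proof.
move=> rG.
have fullG : row_full G by apply/eqP.
have [w w_t] := row_fullP fullG.
have fib u : #|[set v : 'rV[F]_n | v *m G == u]| =
             #|[set v : 'rV[F]_n | v *m G == t]|.
  rewrite -(card_imset _ (addrI ((t - u) *m w))); apply: eq_card => v.
  rewrite inE; apply/imsetP/eqP => [[x]|vt].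
    rewrite inE => /eqP xu ->; rewrite mulmxDl -mulmxA w_t mulmx1 xu.
    by rewrite subrK.
  exists (v - (t - u) *m w); last by rewrite addrC subrK.
  by rewrite inE mulmxBl -mulmxA w_t mulmx1 vt opprB addrC subrK.
have := card_mx F 1 n; rewrite mul1n => <-.
have := card_mx F 1 k; rewrite mul1n => <-.
rewrite -[RHS]sum1_card (partition_big (mulmx^~ G) xpredT) //=.
rewrite mulnC -sum_nat_const; apply: eq_bigr => u _.
by rewrite sum1dep_card fib.
Qed.

(** * Counting the rows of the check matrix by value *)

Section Columns.
Variables (n k : nat) (C : {set 'rV['F_3]_n}) (G : 'M['F_3]_(n, k)).
Hypotheses (perfC : perfect_code C) (rankG : \rank G = k).
Hypothesis constG : forall c d, c \in C -> d \in C -> c *m G = d *m G.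
Hypothesis ball_card : (2 * n + 1 = 3 ^ k.+1)%N.

(* Counts the words [v] satisfying [P] through the unique codeword in the unit
   ball around [v]. *)
Lemma perfect_code_count (P : pred 'rV['F_3]_n) :
  (#|[set v | P v]| = \sum_(c in C) (P c + \sum_(i < n)
     (P (c + delta_mx 0 i)%R + P (c - delta_mx 0 i)%R)))%N.
Proof.
have pick (x : 'rV['F_3]_n) : (\sum_(v | P v) (x == v) = P x)%N.
  rewrite big_mkcond /= (bigD1 x) //= eqxx big1 ?addn0; first by case: (P x).
  by move=> v /negPf; rewrite eq_sym => ->; case: (P v).
rewrite -sum1dep_card.
under eq_bigr => v _ do rewrite -(perfect_code_sum perfC v).
rewrite exchange_big /=; apply: eq_bigr => c _.
rewrite big_split /= pick; congr (_ + _)%N.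
by rewrite exchange_big /=; apply: eq_bigr => i _; rewrite big_split /= !pick.
Qed.

(** All codewords have the same image under [G], so their unit balls meet the fibre over
    [c0 *m G + t] equally often. This fibre has [3 ^ (n - k)] words, and the tiling gives
    [#|C| * 3 ^ k.+1 = 3 ^ n]; the quotient by [#|C|] is 3. *)
Lemma check_row_count (t : 'rV['F_3]_k) :
  ((0 == t)%R + \sum_(i < n) ((row i G == t)%R + (- row i G == t)%R) = 3)%N.
Proof.
have cardF : #|'F_3| = 3%N by rewrite card_Fp.
have cardC : (#|C| * 3 ^ k.+1 = 3 ^ n)%N.
  have := card_mx 'F_3 1 n; rewrite mul1n cardF => <-.
  have := perfect_code_count xpredT; rewrite cardsT => ->.
  rewrite sum_nat_const -ball_card; congr (_ * _)%N.
  by rewrite sum_nat_const card_ord /=; lia.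
have [c0 c0C _] := perfect_code_cover perfC 0.
have Cpos : (0 < #|C|)%N by apply/card_gt0P; exists c0.
have eG (i : 'I_n) : delta_mx 0 i *m G = row i G by rewrite -rowE.
have := card_mulmx_fiber (c0 *m G + t) rankG.
rewrite cardF -cardC perfect_code_count.
have shift (x : 'rV_k) : (c0 *m G + x == c0 *m G + t) = (x == t).
  exact: (inj_eq (addrI _)).
under eq_bigr => c cC.
  rewrite (constG cC c0C) -{1}[c0 *m G]addr0 shift.
  under eq_bigr => i _ do
    rewrite mulmxDl mulmxBl eG (constG cC c0C) !shift.
  over.
rewrite sum_nat_const expnS mulnA => /eqP.
by rewrite eqn_pmul2r ?expn_gt0 // eqn_pmul2l // => /eqP.
Qed.

(** For [t = 0] the centre of the ball counts once and each zero row twice, so [1 + 2 * z = 3]. *)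
Lemma check_zero_rows : #|[set i | row i G == 0]| = 1%N.
Proof.
have := check_row_count 0; rewrite eqxx.
under eq_bigr => i _ do rewrite oppr_eq0.
rewrite big_split -sum1dep_card /=.
rewrite (_ : (\sum_(i | (row i G == 0)%R) 1 = \sum_(i < n) (row i G == 0)%R)%N).
  by move: (bigop _ _ _) => s; lia.
by rewrite big_mkcond; apply: eq_bigr => i _; case: eqP.
Qed.

(** As [t] differs from [0] and from [- t], the centre does not count and each row of the class
    counts once. *)
Lemma check_class_rows (t : 'rV['F_3]_k) : t != 0 ->
  #|[set i | (row i G == t) || (row i G == - t)]| = 3%N.
Proof.
move=> t0; have := check_row_count t; rewrite eq_sym (negPf t0) add0n.
apply: etrans.
rewrite -sum1dep_card big_mkcond /=; apply: eq_bigr => i _.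
rewrite eqr_oppLR; case: eqP => [->|_] /=; last by case: eqP.
by rewrite eq_sym oppr_eq_F3 (negPf t0).
Qed.

End Columns.

(** * Order-3 arithmetic and quasigroups *)

Lemma F3_addxx (a : 'F_3) : a + a + a = 0.
Proof. by case: (F3_cases a) => ->; apply: val_inj. Qed.

Lemma F3_third (a b c d : 'F_3) :
  a != b -> a != c -> b != c -> d != b -> d != c -> d = a.
Proof.
by case: (F3_cases a) => ->; case: (F3_cases b) => ->; case: (F3_cases c) => ->;
  case: (F3_cases d) => ->.
Qed.

(** Two graph points at distance 1 differ either in the value alone, impossible for a function, or
    in one argument alone, excluded by the hypothesis. *)
Lemma quasigroup_hadj (t : nat) (f : 'rV['F_3]_t -> 'F_3) :
  (forall x y, hadj x y -> f x != f y) -> quasigroup f.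
Proof.
move=> f_neq u v /imsetP [x _ ->] /imsetP [y _ ->] xy.
have {}xy : x != y by apply: contra_neq xy => ->.
rewrite ltnNge hdist_le1; apply/norP; split.
  by apply: contra xy => /eqP/eq_row_mx [-> _].
apply/hadjP => -[i [a a0 /rowP E]].
have El j : y 0 j = x 0 j + a * (lshift 1 j == i)%:R.
  have := E (lshift 1 j); rewrite row_mxEl [RHS]mxE row_mxEl => ->.
  by rewrite !mxE.
have Er : f y = f x + a * (rshift t (0 : 'I_1) == i)%:R.
  have := E (rshift t 0).
  by rewrite row_mxEr [RHS]mxE row_mxEr ![const_mx _ _ _]mxE !mxE.
case: (split_ordP i) El Er => j -> El Er; last first.
  case/eqP: xy; apply/rowP => k.
  by rewrite El eq_lrshift mulr0 addr0.
have : hadj x y.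
  apply/hadjP; exists j, a => //; apply/rowP => k.
  by rewrite El !mxE eqxx /= (inj_eq (@lshift_inj t 1)).
move=> /f_neq; rewrite Er eq_rlshift mulr0 addr0.
by rewrite eqxx.
Qed.

(* A position is [Some (j, l)], the [l]-th of the three in block [j], or [None],
   the last one. Indexing by ['F_3] makes the third position of a block [-1]. *)
Section Blocks.
Variables (n N : nat) (e : option ('I_N * 'F_3) -> 'I_n).
Variables (g : 'I_n -> option ('I_N * 'F_3)).
Hypotheses (eK : cancel e g) (gK : cancel g e).
Implicit Types (x y : 'rV['F_3]_n) (mu d : 'rV['F_3]_N) (j : 'I_N).
Implicit Types (l a c : 'F_3) (f : 'F_3 -> 'F_3).

(** * Block sums, block differences and moves within a block *)

Definition blk_sum x : 'rV['F_3]_N := \row_j (x 0 (e (Some (j, 0))) +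
  x 0 (e (Some (j, 1))) + x 0 (e (Some (j, -1)))).

Definition blk_diff x : 'rV['F_3]_N :=
  \row_j (x 0 (e (Some (j, 1))) - x 0 (e (Some (j, 0)))).

Definition upd_last x c : 'rV['F_3]_n :=
  \row_i (if g i is Some _ then x 0 i else c).

Definition blk_shift j f : 'rV['F_3]_n :=
  \row_i (if g i is Some (j', l) then f l *+ (j' == j) else 0).

(** The word with block sums [mu] and block differences [d], normalised to have 0 at the first
    position of every block. *)
Definition blk_word mu d c : 'rV['F_3]_n :=
  \row_i (if g i is Some (j, l) then
    (if l == 0 then 0 else if l == 1 then d 0 j else mu 0 j - d 0 j) else c).

Lemma blk_sum_upd x c : blk_sum (upd_last x c) = blk_sum x.
Proof. by apply/rowP => j; rewrite !mxE !eK. Qed.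

Lemma upd_last_id x : upd_last x (x 0 (e None)) = x.
Proof.
by apply/rowP => i; rewrite mxE -{3}(gK i); case: (g i) (gK i) => [p ->|].
Qed.

Lemma blk_sum_shift x j f : f 0 + f 1 + f (-1) = 0 ->
  blk_sum (x + blk_shift j f) = blk_sum x.
Proof.
move=> f0; apply/rowP => j'; rewrite !mxE !eK.
case: (j' == j); rewrite ?mulr0n ?addr0 // !mulr1n.
by rewrite -[RHS]addr0 -[X in _ = _ + X]f0; ring.
Qed.

Lemma blk_sum_word mu d c : blk_sum (blk_word mu d c) = mu.
Proof. by apply/rowP => j; rewrite !mxE !eK /= add0r addrC subrK. Qed.

Lemma blk_sum_delta x a j l :
  blk_sum (x + a *: delta_mx 0 (e (Some (j, l)))) =
  blk_sum x + a *: delta_mx 0 j.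
Proof.
apply/rowP => j'; rewrite !mxE !(inj_eq (can_inj eK)) !eqxx /=.
rewrite !(inj_eq Some_inj) !xpair_eqE.
case: (j' == j) => /=; last by rewrite !mulr0 !addr0.
have l1 : (0 == l)%:R + (1 == l)%:R + (-1 == l)%:R = 1 :> 'F_3.
  by case: (F3_cases l) => ->; apply/eqP.
by rewrite -[X in _ = _ + X]mulr1 -[X in _ = _ + _ * X]l1; ring.
Qed.

(** * The last coordinate as a 3-colouring *)

Variables (D : {set 'rV['F_3]_n}) (S : {set 'rV['F_3]_N}).
Hypothesis Ddist :
  forall x y, x \in D -> y \in D -> (hdist x y <= 2)%N -> x = y.
Hypothesis Dcover : forall x, exists2 y, y \in D & (hdist x y <= 1)%N.
Hypothesis Ssep : forall mu nu, mu \in S -> nu \in S -> ~~ hadj mu nu.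
Hypothesis Dsum : forall x, x \in D -> blk_sum x \in S.

(** The colour of [x]. By [last_ofP], the default 0 is reached only when [blk_sum x] lies outside
    [S]. *)
Definition last_of x : 'F_3 := odflt 0 [pick c | upd_last x c \in D].

(** An element of [D] within distance 1 of [x] cannot differ from [x] inside a block, since its
    block sums would be a word of [S] adjacent to [blk_sum x]. It can differ only in the last
    coordinate. *)
Lemma last_ofP x : blk_sum x \in S -> upd_last x (last_of x) \in D.
Proof.
move=> xS; rewrite /last_of; case: pickP => //= noc.
have [c cD] := Dcover x; rewrite hdist_le1 => /orP [/eqP xc|].
  by have := noc (x 0 (e None)); rewrite upd_last_id xc cD.
case/hadjP => i [a a0 cE]; move: cE; rewrite -(gK i).
case: (g i) => [[j l]|] cE.
  have := Ssep xS (Dsum cD); rewrite cE blk_sum_delta => /negP [].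
  by apply/hadjP; exists j, a.
have := noc (c 0 (e None)); rewrite (_ : upd_last _ _ = c) ?cD //.
rewrite -[RHS]upd_last_id; apply/rowP => k; rewrite mxE [RHS]mxE.
case gk: (g k) => [p|//]; rewrite cE !mxE -(gK k) gk.
by rewrite (inj_eq (can_inj eK)) andbF mulr0 addr0.
Qed.

Lemma last_of_upd x c : last_of (upd_last x c) = last_of x.
Proof.
rewrite /last_of; congr odflt; apply: eq_pick => a; congr (_ \in D).
by apply/rowP => i; rewrite !mxE; case: (g i).
Qed.

Lemma mem_last_of x :
  (x \in D) = (blk_sum x \in S) && (x 0 (e None) == last_of x).
Proof.
apply/idP/andP => [xD|[xS /eqP xl]]; last first.
  by rewrite -[x]upd_last_id xl last_ofP.
have xS := Dsum xD; split=> //; have uD := last_ofP xS.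
rewrite {1}(_ : x = upd_last x (last_of x)); first by rewrite mxE eK.
apply: Ddist => //; apply: (@leq_trans #|[set e None]|); last by rewrite cards1.
apply/subset_leq_card/subsetP => i; rewrite !inE mxE.
by case gi: (g i) => [p|]; rewrite ?eqxx // => _; rewrite -(gK i) gi.
Qed.

(** With equal colours, the two completed words of [D] would differ at most at [p1] and [p2], hence
    coincide by [Ddist], against their entries at [p1]. *)
Lemma last_of_neq x y p1 p2 : blk_sum x \in S -> blk_sum y \in S ->
  x 0 (e (Some p1)) != y 0 (e (Some p1)) ->
  (forall p, p != p1 -> p != p2 -> x 0 (e (Some p)) = y 0 (e (Some p))) ->
  last_of x != last_of y.
Proof.
move=> /last_ofP xD /last_ofP yD xy1 xy; apply: contra xy1 => /eqP lxy.
suff /rowP/(_ (e (Some p1))) : upd_last x (last_of x) = upd_last y (last_of y).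
  by rewrite !mxE !eK => ->.
apply: Ddist => //.
apply: (@leq_trans #|[set e (Some p1); e (Some p2)]|); last first.
  by rewrite cards2; case: (_ != _).
apply/subset_leq_card/subsetP => i; rewrite !inE !mxE -(gK i) eK.
case: (g i) => [p|]; last by rewrite lxy eqxx.
rewrite !(inj_eq (can_inj eK)) !(inj_eq Some_inj).
by apply: contraR => /norP [p_1 p_2]; rewrite xy.
Qed.

Lemma last_of_shift_neq x j f f' l1 l2 : blk_sum x \in S ->
  f 0 + f 1 + f (-1) = 0 -> f' 0 + f' 1 + f' (-1) = 0 ->
  f l1 != f' l1 -> (forall l, l != l1 -> l != l2 -> f l = f' l) ->
  last_of (x + blk_shift j f) != last_of (x + blk_shift j f').
Proof.
move=> xS f0 f'0 ff1 ff.
apply: (@last_of_neq _ _ (j, l1) (j, l2)); rewrite ?blk_sum_shift //.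
  by rewrite !mxE !eK eqxx !mulr1n (inj_eq (addrI _)).
move=> [j' l]; rewrite !mxE !eK !xpair_eqE.
case: (j' == j) => //= l_1 l_2; by rewrite ff.
Qed.

(* The nine triples with a given sum form, for the relation of being at distance
   2, the complete tripartite graph K_{3,3,3} whose parts are the cosets of
   (1, 1, 1), and a proper 3-colouring of it is constant on each part. *)
Lemma last_of_shift x j a : blk_sum x \in S ->
  last_of (x + blk_shift j (fun=> a)) = last_of x.
Proof.
move=> xS.
(* The triples 0, [f1 = (a, -a, 0)] and [f2 = (a, 0, -a)] lie in different parts and take all three
   colours. As [(a, a, a)] is at distance 2 from [f1] and [f2], it has the colour of 0. *)
pose f1 l : 'F_3 := if l == 0 then a else if l == 1 then - a else 0.
pose f2 l : 'F_3 := if l == 0 then a else if l == 1 then 0 else - a.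
have x0 : x = x + blk_shift j (fun=> 0).
  by apply/rowP => i; rewrite !mxE; case: (g i) => [[? ?]|];
    rewrite ?mul0rn addr0.
have s0 : 0 + 0 + 0 = 0 :> 'F_3 by rewrite !addr0.
have sa := F3_addxx a.
have s1 : f1 0 + f1 1 + f1 (-1) = 0 by rewrite /f1 /= subrr addr0.
have s2 : f2 0 + f2 1 + f2 (-1) = 0 by rewrite /f2 /= addr0 subrr.
have [->|a0] := eqVneq a 0; first by rewrite -x0.
have aNa : a != - a by case: (F3_cases a) a0 => ->.
have Na0 : - a != 0 by rewrite oppr_eq0.
have n01 : last_of x != last_of (x + blk_shift j f1).
  rewrite {1}x0; apply: (@last_of_shift_neq _ _ _ _ 0 1) => //.
    by rewrite /f1 /= eq_sym.
  by move=> l /negPf l0 /negPf l1; rewrite /f1 l0 l1.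
have n02 : last_of x != last_of (x + blk_shift j f2).
  rewrite {1}x0; apply: (@last_of_shift_neq _ _ _ _ 0 (-1)) => //.
    by rewrite /f2 /= eq_sym.
  by move=> l; case: (F3_cases l) => ->.
have n12 : last_of (x + blk_shift j f1) != last_of (x + blk_shift j f2).
  apply: (@last_of_shift_neq _ _ _ _ 1 (-1)) => //.
  by move=> l; case: (F3_cases l) => ->.
have na1 : last_of (x + blk_shift j (fun=> a)) != last_of (x + blk_shift j f1).
  apply: (@last_of_shift_neq _ _ _ _ 1 (-1)) => //.
  by move=> l; case: (F3_cases l) => ->.
have na2 : last_of (x + blk_shift j (fun=> a)) != last_of (x + blk_shift j f2).
  apply: (@last_of_shift_neq _ _ _ _ 1 (-1)) => //.
  by move=> l; case: (F3_cases l) => ->.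
exact: F3_third n01 n02 n12 na1 na2.
Qed.

Lemma last_of_shifts x (t : 'I_N -> 'F_3) (s : seq 'I_N) : blk_sum x \in S ->
  last_of (x + \sum_(j <- s) blk_shift j (fun=> t j)) = last_of x.
Proof.
move=> xS; elim: s x xS => [|j s IH] x xS; first by rewrite big_nil addr0.
by rewrite big_cons addrA IH ?blk_sum_shift ?F3_addxx // last_of_shift.
Qed.

(** Setting the last coordinate of the normalised word to that of [x], and shifting each block by
    the first entry of that block in [x], recovers [x] without changing the colour. The third
    entries agree because 3 vanishes in ['F_3]. *)
Lemma last_of_word x : blk_sum x \in S ->
  last_of x = last_of (blk_word (blk_sum x) (blk_diff x) 0).
Proof.
move=> xS; rewrite -[RHS](last_of_upd _ (x 0 (e None))).
rewrite -[RHS](last_of_shifts (fun j => x 0 (e (Some (j, 0)))) (enum 'I_N)).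
  congr last_of; apply/rowP => i; rewrite -(gK i) !mxE summxE.
  under eq_bigr => j _ do rewrite mxE eK.
  rewrite !eK; case: (g i) => [[j l]|]; last by rewrite big1 // addr0.
  rewrite big_enum (bigD1 j) //= eqxx big1 => [|k /negPf]; last first.
    by rewrite eq_sym => ->.
  case: (F3_cases l) => -> /=; rewrite ?mxE ?mulr1n ?addr0 ?add0r ?subrK //.
  set u := x _ _; set v := x _ _; set w := x _ _.
  by rewrite -[LHS]addr0 -[X in _ + X = _](F3_addxx v); ring.
by rewrite blk_sum_upd blk_sum_word.
Qed.

(** Changing one argument [d 0 j] alters the normalised word only at the second and third positions
    of block [j], so [last_of_neq] gives the quasigroup property. *)
Lemma blk_code : exists lambda : 'rV['F_3]_N -> 'rV['F_3]_N -> 'F_3,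
  (forall mu, mu \in S -> quasigroup (lambda mu)) /\
  forall x, (x \in D) = (blk_sum x \in S) &&
    (x 0 (e None) == lambda (blk_sum x) (blk_diff x)).
Proof.
exists (fun mu d => last_of (blk_word mu d 0)); split=> [mu muS|x].
  apply: quasigroup_hadj => d d' /hadjP [j [a a0 ->]].
  apply: (@last_of_neq _ _ (j, 1) (j, -1)); rewrite ?blk_sum_word //.
    rewrite !mxE !eK /= !mxE !eqxx /= mulr1 -{1}[d 0 j]addr0.
    by rewrite (inj_eq (addrI _)) eq_sym.
  move=> [j' l]; rewrite !xpair_eqE !mxE !eK /= !mxE /=.
  have [_|_] := eqVneq j' j => /=; last by rewrite mulr0 addr0.
  by case: (F3_cases l) => ->.
rewrite mem_last_of; case xS: (blk_sum x \in S) => //=.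
by rewrite -last_of_word.
Qed.

End Blocks.

(** * Numbering of the positions and the sets [Kset] *)

(** The element [-1] of ['F_3] coerces to the number 2, hence is the third position of its block. *)
Definition slot (N : nat) (o : option ('I_N * 'F_3)) : nat :=
  if o is Some (j, l) then (3 * j + l)%N else (3 * N)%N.

Lemma ltn_F3 (l : 'F_3) : (l < 3)%N.
Proof. exact: ltn_ord. Qed.

Lemma slot_bij (n N : nat) : n = (3 * N + 1)%N ->
  exists (e : option ('I_N * 'F_3) -> 'I_n) g,
    [/\ cancel e g, cancel g e & forall o, e o = slot o :> nat].
Proof.
move=> nE.
have ltn (o : option ('I_N * 'F_3)) : (slot o < n)%N.
  rewrite nE; case: o => [[j l]|] /=; last by lia.
  by have := ltn_F3 l; have := ltn_ord j; lia.
pose e o := Ordinal (ltn o).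
have e_inj : injective e.
  move=> [[j l]|] [[j' l']|] //= [].
  - have := ltn_F3 l; have := ltn_F3 l' => l3 l3' jl.
    by congr (Some (_, _)); apply: val_inj => /=; lia.
  - by have := ltn_F3 l; have := ltn_ord j; lia.
  - by have := ltn_F3 l'; have := ltn_ord j'; lia.
have [g eK gK] : bijective e.
  apply: inj_card_bij => //.
  rewrite card_option card_prod !card_ord nE (_ : (Zp_trunc _).+2 = 3%N) //.
  by lia.
by exists e, g.
Qed.

Lemma Kset_blk (k : nat) (e : option ('I_(hlen k) * 'F_3) -> 'I_(hlen k.+1))
    (mu : 'rV['F_3]_(hlen k)) (lambda : 'rV['F_3]_(hlen k) -> 'F_3) x :
  (forall o, e o = slot o :> nat) ->
  (x \in @Kset k.+1 mu lambda) =
    (blk_sum e x == mu) && (x 0 (e None) == lambda (blk_diff e x)).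
Proof.
move=> eE; rewrite inE.
have ent o : entry x (slot o) = x 0 (e o) by rewrite -eE entryE.
have ent0 (i : 'I_(hlen k)) : entry x (3 * i)%N = x 0 (e (Some (i, 0))).
  by rewrite -ent /= addn0.
have ent1 (i : 'I_(hlen k)) : entry x (3 * i + 1)%N = x 0 (e (Some (i, 1))).
  by rewrite -ent.
have ent2 (i : 'I_(hlen k)) : entry x (3 * i + 2)%N = x 0 (e (Some (i, -1))).
  by rewrite -ent.
have entN : entry x (hlen k.+1).-1 = x 0 (e None).
  by rewrite -ent; congr (entry x _); rewrite hlenE //= addn1.
congr (_ && _).
  apply/forallP/eqP => [E|<- i].
    apply/rowP => i; rewrite mxE; move: (E i).
    by rewrite ent0 ent1 ent2 => /eqP ->; ring.
  by rewrite ent0 ent1 ent2 mxE; apply/eqP; ring.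
rewrite entN; congr (_ == lambda _); apply/rowP => i.
by rewrite !mxE ent0 ent1.
Qed.

(** * Automorphisms and the normal form of the checks *)

Lemma hamming_automorphism_hdist (n : nat)
    (psi : 'rV['F_3]_n -> 'rV['F_3]_n) :
  hamming_automorphism psi -> forall x y, hdist (psi x) (psi y) = hdist x y.
Proof.
move=> [p [s psiE]] x y; rewrite /hdist.
rewrite -(card_preimset [set i | x 0 i != y 0 i] (@perm_inj _ p)).
by apply: eq_card => i; rewrite !inE !psiE !mxE (inj_eq (@perm_inj _ (s i))).
Qed.

Lemma hamming_automorphism_bij (n : nat)
    (psi : 'rV['F_3]_n -> 'rV['F_3]_n) :
  hamming_automorphism psi -> bijective psi.
Proof.
move=> /hamming_automorphism_hdist psi_d; apply: injF_bij => x y /eqP.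
by rewrite -hdist_eq0 psi_d hdist_eq0 => /eqP.
Qed.

Lemma sum_slots (V : zmodType) (N : nat) (F : option ('I_N * 'F_3) -> V) :
  \sum_o F o =
  F None + \sum_j (F (Some (j, 0)) + F (Some (j, 1)) + F (Some (j, -1))).
Proof.
rewrite (bigD1 None) //=; congr (_ + _).
rewrite (reindex_omap Some id) /=; last by case.
rewrite (eq_bigl xpredT); last by move=> p; rewrite eqxx.
rewrite (eq_bigr (fun p => F (Some (p.1, p.2)))); last by case.
rewrite -(pair_bigA _ (fun j l => F (Some (j, l)))) /=; apply: eq_bigr => j _.
rewrite (bigD1 0) // (bigD1 1) // (bigD1 (-1)) //= big1 ?addr0 ?addrA //.
by move=> l; case: (F3_cases l) => ->.
Qed.

(** When [c] is a codeword and the [h j] are the columns of a check matrix, the right side vanishes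
    on the code, so the block sums of [psi x] satisfy these checks. *)
Lemma hamming_normal_form (n N k : nat)
    (e : option ('I_N * 'F_3) -> 'I_n) (g : 'I_n -> option ('I_N * 'F_3))
    (G : 'M['F_3]_(n, k)) (h : 'I_N -> 'rV['F_3]_k) (c : 'rV['F_3]_n) :
  cancel e g -> cancel g e ->
  #|[set i | row i G == 0]| = 1%N ->
  (forall t, t != 0 -> #|[set i | (row i G == t) || (row i G == - t)]| = 3%N) ->
  (forall j, h j != 0) ->
  (forall i j, (h i == h j) || (h i == - h j) -> i = j) ->
  exists2 psi, hamming_automorphism psi &
    forall x, \sum_j blk_sum e (psi x) 0 j *: h j = (x - c) *m G.
Proof.
move=> eK gK /eqP/cards1P [i0 /setP/(_ i0)]; rewrite !inE eqxx => /eqP r0.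
move=> card3 h0 h_inj.
pose cl j := [set i | (row i G == h j) || (row i G == - h j)].
have clE j : #|cl j| = 3%N by apply: card3.
(* The three rows equal to [h j] or [- h j] fill block [j]; the zero row takes the last position. *)
pose q o := if o is Some (j, l) then enum_val (cast_ord (esym (clE j)) l)
            else i0.
have q_cl j l : q (Some (j, l)) \in cl j by apply: enum_valP.
have cl_neq0 j i : i \in cl j -> row i G != 0.
  by rewrite inE => /orP [] /eqP ->; rewrite ?oppr_eq0.
have cl_inj i j j' : i \in cl j -> i \in cl j' -> j = j'.
  rewrite !inE => /orP [] /eqP -> hj; apply: h_inj => //.
  by rewrite -eqr_oppLR -[h j == h j']eqr_opp orbC.
have q_inj : injective q.
  move=> [[j l]|] [[j' l']|] //= E.
  - have jj' : j = j'.
      by apply: (@cl_inj (q (Some (j, l)))); rewrite // [q _]E q_cl.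
    move: E; rewrite -jj'; move/enum_val_inj/cast_ord_inj => ->; done.
  - by have := cl_neq0 _ _ (q_cl j l); rewrite /q E r0 eqxx.
  - by have := cl_neq0 _ _ (q_cl j' l'); rewrite /q -E r0 eqxx.
have qg_inj : injective (q \o g) by apply: inj_comp q_inj (can_inj gK).
pose p := perm qg_inj.
(* For [i] in block [j], this is the sign with [row (p i) G = eps i *: h j]. *)
pose eps i : 'F_3 :=
  if g i is Some (j, _) then (if row (p i) G == h j then 1 else -1) else 1.
have s_inj i : injective (fun z => eps i * (z - c 0 (p i))).
  apply: (can_inj (g := fun z => eps i * z + c 0 (p i))) => z.
  rewrite mulrA (_ : eps i * eps i = 1) ?mul1r ?subrK //.
  by rewrite /eps; case: (g i) => [[j l]|]; rewrite ?mulr1 //;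
    case: ifP => _; rewrite ?mulr1 // mulrNN mulr1.
exists (isotopy (fun i => perm (@s_inj i)) \o col_perm p).
  by exists p, (fun i => perm (@s_inj i)).
move=> x; rewrite mulmx_sum_row.
have q_bij : bijective q.
  apply: inj_card_bij => //; rewrite -(card_codom (can_inj gK)).
  exact: max_card.
rewrite (reindex q) ?sum_slots /=; last exact: onW_bij.
rewrite r0 scaler0 add0r; apply: eq_bigr => j _.
have term l : isotopy (fun i => perm (@s_inj i)) (col_perm p x) 0
    (e (Some (j, l))) *: h j =
    (x - c) 0 (q (Some (j, l))) *: row (q (Some (j, l))) G.
  rewrite !mxE permE /eps eK /p permE /= eK mulrC -scalerA; congr (_ *: _).
  have := q_cl j l; rewrite inE; case: eqP => [->|_ /= /eqP ->].
    by rewrite scale1r.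
  by rewrite scaleN1r.
by rewrite [blk_sum _ _ _ _]mxE !scalerDl !term.
Qed.

(** * Application to the Hamming code *)

Lemma hlen_double (m : nat) : (2 * hlen m + 1 = 3 ^ m)%N.
Proof.
have : odd (3 ^ m) by rewrite oddX orbT.
by rewrite /hlen; move: (3 ^ m)%N => k; lia.
Qed.

Theorem theorem1 (m : nat) (hm : (2 <= m)%N)
    (C : {set 'rV['F_3]_(hlen m)}) (hC : perfect_code C)
    (hrank : (code_rank C <= hlen m - m + 1)%N)
    (Cstar : {set 'rV['F_3]_(hlen m.-1)}) (hCstar : hamming_code Cstar) :
  exists psi : 'rV['F_3]_(hlen m) -> 'rV['F_3]_(hlen m),
    hamming_automorphism psi /\
    exists lambda : 'rV['F_3]_(hlen m.-1) -> 'rV['F_3]_(hlen m.-1) -> 'F_3,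
      (forall mu, mu \in Cstar -> quasigroup (lambda mu)) /\
      psi @: C = \bigcup_(mu in Cstar) Kset mu (lambda mu).
Proof.
case: m hm C hC hrank Cstar hCstar => // k k1 C perfC rankC Cstar.
rewrite [k.+1.-1]/= in Cstar * => -[H [[H0 Hcol _] CstarE]].
(* This makes the truncated subtraction in the rank bound exact, so that the bound becomes
   [hlen k.+1 - k] and yields [k] checks. *)
have k_lt : (k < hlen k.+1)%N.
  by have := hlen_double k.+1; have := ltn_expl k (isT : (1 < 3)%N);
    rewrite expnS; lia.
have [|G rankG constG] := @code_rank_check _ k C (ltnW k_lt).
  by apply: leq_trans rankC _; lia.
have ballE := hlen_double k.+1.
have [e [g [eK gK eE]]] := slot_bij (hlenE (ltn0Sn k)).
have [c0 c0C _] := perfect_code_cover perfC 0.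
pose h j := (col j H)^T.
have h0 j : h j != 0 by rewrite trmx_eq0.
have h_inj i j : (h i == h j) || (h i == - h j) -> i = j.
  move=> hij; apply: contraTeq hij => /Hcol ncol; apply/norP.
  split; apply/negP => /eqP /(congr1 trmx); rewrite ?linearN /= !trmxK => hij;
    apply: ncol; left; [exists 1 | exists (-1)];
    by rewrite ?scale1r ?scaleN1r.
have [psi psiA psiE] := hamming_normal_form c0 eK gK
  (check_zero_rows perfC rankG constG ballE)
  (fun t => @check_class_rows _ _ _ _ perfC rankG constG ballE t) h0 h_inj.
exists psi; split=> //.
have CstarH mu : (mu \in Cstar) = (mu *m H^T == 0).
  by rewrite CstarE inE -trmx_eq0 trmx_mul trmxK.
have psid := hamming_automorphism_hdist psiA.
have [phi psiK phiK] := hamming_automorphism_bij psiA.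
have [x y|x|mu nu|x|lambda [quasi DE]] :=
    @blk_code _ _ e g eK gK (psi @: C) Cstar.
- move=> /imsetP [c cC ->] /imsetP [d dC ->]; rewrite psid => cd.
  by rewrite (perfect_code_dist perfC cC dC cd).
- have [c cC] := perfect_code_cover perfC (phi x).
  by rewrite -psid phiK => xc; exists (psi c); rewrite ?imset_f.
(* Two adjacent words in the kernel of [H] would force a column of [H] to be zero. *)
- rewrite !CstarH => /eqP mu0 /eqP nu0; apply/hadjP => -[j [a a0 nuE]].
  have /eqP := nu0; rewrite nuE mulmxDl mu0 add0r -scalemxAl -rowE -tr_col.
  by rewrite scaler_eq0 (negPf a0) (negPf (h0 j)).
(* The syndrome of the block sums is [(c - c0) *m G], which is zero because [G] is constant on
   [C]. *)
- move=> /imsetP [c cC ->]; rewrite CstarH mulmx_sum_row.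
  under eq_bigr => j _ do rewrite -tr_col.
  by rewrite psiE mulmxBl (constG _ _ cC c0C) subrr.
exists lambda; split=> //; apply/setP => x; rewrite DE.
apply/andP/bigcupP => [[xC xl]|[mu muC]].
  by exists (blk_sum e x); rewrite // (Kset_blk _ _ _ eE) eqxx.
by rewrite (Kset_blk _ _ _ eE) => /andP [/eqP -> ->].
Qed.
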